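(* Let $P(\mathbf{x},\mathbf{y})$ be a $4\times 3$ positive semidefinite biquadratic form in $\mathbf{x}=(x_1,x_2,x_3,x_4)$ and $\mathbf{y}=(y_1,y_2,y_3)$ that is $y$-deficient with deficiency in $y_3$ (i.e. the deficiency condition holds with $j_0=3$). Then $\operatorname{sos}(P)\le 9$, i.e. $P$ can be written as a sum of at most $9$ squares of real bilinear forms in $\mathbf{x}$ and $\mathbf{y}$.
   Context: An $m\times n$ biquadratic form in variables $\mathbf{x}=(x_1,\dots,x_m)$ and $\mathbf{y}=(y_1,\dots,y_n)$ is a polynomial $P(\mathbf{x},\mathbf{y})=\sum_{i,k=1}^{m}\sum_{j,l=1}^{n}a_{ijkl}\,x_ix_ky_jy_l$ with real coefficients. It is positive semidefinite (PSD) if $P(\mathbf{x},\mathbf{y})\ge 0$ for all real $\mathbf{x},\mathbf{y}$. It is sum-of-squares (SOS) if it can be written as a finite sum of squares of real bilinear forms $\ell(\mathbf{x},\mathbf{y})=\sum_{i=1}^{m}\sum_{j=1}^{n}c_{ij}x_iy_j$; the smallest number of squares in such a representation is its SOS rank $\operatorname{sos}(P)$. The form $P$ is called $y$-deficient if there exists an index $j_0\in\{1,\dots,n\}$ (and one says the deficiency is in $y_{j_0}$) such that no term of $P$ contains the variable $y_{j_0}$ together with any other $y_j$ ($j\ne j_0$) or any product $x_ix_k$ with $i\neq k$; equivalently, every term (monomial with nonzero coefficient) of $P$ involving $y_{j_0}$ is a real multiple of a pure square monomial $x_i^2y_{j_0}^2$. *)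

(* Defs.v *)
From HB Require Import structures.
From mathcomp Require Import all_boot all_order all_algebra.
From mathcomp Require Import reals.
From mathcomp Require Import mpoly.

Set Implicit Arguments.
Unset Strict Implicit.
Unset Printing Implicit Defensive.

Import Order.TTheory GRing.Theory Num.Theory.
Local Open Scope ring_scope.

(* Polynomials in x_1, ..., x_m, y_1, ..., y_n: the m variables x come first.
   Spelled without the notation {mpoly R[m + n]} so that clients need not
   import mpoly, whose notations clash with those of mathcomp-analysis. *)
Notation bipoly R m n := (mpoly.mpoly (m + n) R).

Section Biquadratic.

Context {R : realType} {m n : nat}.

Implicit Types (P : bipoly R m n) (i k : 'I_m) (j l : 'I_n).

Definition xidx i : 'I_(m + n) := lshift n i.
Definition yidx j : 'I_(m + n) := rshift m j.

Definition xvar i : bipoly R m n := 'X_(xidx i).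
Definition yvar j : bipoly R m n := 'X_(yidx j).

Definition biquadratic_form P : Prop :=
  exists a : 'I_m -> 'I_m -> 'I_n -> 'I_n -> R,
    P = \sum_(i < m) \sum_(k < m) \sum_(j < n) \sum_(l < n)
          a i k j l *: (xvar i * xvar k * yvar j * yvar l).

Definition bilinear_form (c : 'M[R]_(m, n)) : bipoly R m n :=
  \sum_(i < m) \sum_(j < n) c i j *: (xvar i * yvar j).

Definition psd P : Prop :=
  forall (x : 'rV[R]_m) (y : 'rV[R]_n), 0 <= P.@[row_mx x y 0].

(* The terms of P are the monomials of [msupp P], i.e. after collecting equal
   monomials; [t v] is the exponent of the variable of index v in t. *)
Definition y_deficient_in j0 P : Prop :=
  forall t : 'X_{1..m + n}, t \in msupp P -> (0 < t (yidx j0))%N ->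
    (forall j, j != j0 -> t (yidx j) = 0%N) /\
    (forall i k, i != k -> ~ ((0 < t (xidx i))%N /\ (0 < t (xidx k))%N)).

Definition sum_of_squares r P : Prop :=
  exists c : 'I_r -> 'M[R]_(m, n), P = \sum_(s < r) bilinear_form (c s) ^+ 2.

(* A relation rather than a function: sos(P) exists only when P is SOS. *)
Definition has_sos_rank P (r : nat) : Prop :=
  sum_of_squares r P /\ forall s, sum_of_squares s P -> (r <= s)%N.

Definition sos_rank_le P (b : nat) : Prop :=
  exists r, has_sos_rank P r /\ (r <= b)%N.

End Biquadratic.

(* Main.v *)
Require Import Defs.
From HB Require Import structures.
From mathcomp Require Import all_boot all_order all_algebra.
From mathcomp Require Import reals boolp.
From mathcomp Require Import ring lra zify.
From mathcomp Require Import perm polyrcf complex mpoly.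

Set Implicit Arguments.
Unset Strict Implicit.
Unset Printing Implicit Defensive.

Import Order.TTheory GRing.Theory Num.Theory.

(** The deficiency hypothesis splits the form as P = Q + y_3^2 (sum of the
d_i x_i^2), where Q is a biquadratic form in x and (y_1, y_2) only. Both
parts are nonnegative, being restrictions of P, and the second one is visibly
a sum of four squares. So everything rests on the fact that a PSD m x 2
biquadratic form is a sum of m + 1 squares; this gives 5 + 4 = 9 for m = 4.

Put y = (1, t). Then Q becomes a symmetric m x m matrix M(t) over R[t], PSD at
every real t, and the claim is that M = N N^T with N of size m x (m+1)
([psd_pmx_factorization]). The entries of N then automatically have degree at
most 1, because the squares of the entries of a row add up to a diagonal entry
of M, of degree at most 2 ([linear_factorization]). A column of N is thus a
bilinear form in x and (1, t).

The factorization is obtained by regarding a symmetric matrix G over R[t] as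
the Gram matrix of a quadratic lattice R[t]^n. If det M is not 0, the lattice
G = <det M> + M, of rank m + 1, has determinant (det M)^2, a square. As long as
this determinant is not constant, the lattice has an integral overlattice with
smaller determinant: let z be a complex root of det G, and p the minimal
polynomial of z over R. One needs a vector v, nonzero mod p, such that v G is
divisible by p and v G v^T by p^2; then v / p can be adjoined. If z is real, a
kernel vector of G(z) works because v G v^T is nonnegative and so has a double
root at z. If z is not real, the residue field R[t]/(p) is the algebraically
closed field C, and the divisibility of det G by p^2 produces v: either the
kernel of G(z) is a line, and then v G v^T vanishes to second order, or it has
dimension at least 2 and contains an isotropic vector of the form induced by
G / p ([isotropic_kernel]). In the end G = S G' S^T with det G' a
nonzero constant ([maximal_overlattice]).

A PSD lattice of constant determinant has a constant Gram matrix in a suitable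
basis: when diagonal degrees 2 d_i are not all 0, the matrix of the
coefficients of degree d_i + d_j is singular, and a vector of its kernel tells
how to change one basis vector so as to lower its degree
([degree_reduction]). A constant PSD matrix is L L^T by Cholesky. Finally, if
det M = 0, the same degree reduction has to end with a zero diagonal entry,
hence with a zero row and column, and induction on m applies. *)

(** * Nonnegative polynomials in one variable *)

Section NonnegativePolynomials.

Local Open Scope ring_scope.

Variable R : rcfType.
Implicit Types f g p : {poly R}.

Definition poly_ge0 f := forall t : R, 0 <= f.[t].

Lemma poly_ge0_lead_coef f : poly_ge0 f -> 0 <= lead_coef f.
Proof.
move=> f_ge0; rewrite leNgt; apply/negP => lf_lt0.
have lNf_gt0 : 0 < lead_coef (- f) by rewrite lead_coefN oppr_gt0.
have [t /(_ t (lexx t))] := poly_pinfty_gt_lc lNf_gt0.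
by rewrite hornerN leNgt (le_lt_trans _ lNf_gt0) // oppr_le0.
Qed.

(** f(-t) is nonnegative as well, and its leading coefficient is that of f times
(-1)^deg f. *)
Lemma poly_ge0_odd_size f : poly_ge0 f -> f != 0 -> odd (size f).
Proof.
move=> f_ge0 f_neq0; have lf_gt0 : 0 < lead_coef f.
  by rewrite lt0r lead_coef_eq0 f_neq0 poly_ge0_lead_coef.
have: poly_ge0 (f \Po - 'X).
  by move=> t; rewrite horner_comp.
move/poly_ge0_lead_coef; rewrite lead_coef_comp ?size_polyN ?size_polyX //.
rewrite lead_coefN lead_coefX -signr_odd; case Ho: (odd _) => /=.
  by rewrite expr1 mulrN1 oppr_ge0 leNgt lf_gt0.
by move: f_neq0 Ho; rewrite -size_poly_gt0; case: (size f) => //= n _ ->.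
Qed.

(** Otherwise the leading coefficient of g - f^2 would be minus a square. *)
Lemma size_sqr_le_of_dominated f g : poly_ge0 (g - f ^+ 2) -> (size (f ^+ 2) <= size g)%N.
Proof.
move=> /poly_ge0_lead_coef lc_ge0; rewrite leqNgt; apply/negP => sz.
move: lc_ge0; rewrite addrC lead_coefDl ?size_polyN // lead_coefN lead_coef_exp.
rewrite oppr_ge0 leNgt lt0r sqr_ge0 sqrf_eq0 lead_coef_eq0 andbT.
by case: eqVneq sz => // ->; rewrite expr0n /= size_poly0.
Qed.

Lemma poly_lt0_near f (a : R) : f.[a] < 0 ->
  exists2 d, 0 < d & forall y, `|y - a| < d -> f.[y] < 0.
Proof.
move=> fa; have e_gt0 : 0 < - f.[a] by rewrite oppr_gt0.
have [d d_gt0 dP] := poly_cont a f e_gt0; exists d => // y /dP.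
by move/ltr_normlW => ?; lra.
Qed.

(** Where f is negative it is so on an interval, and p would have to vanish
there. *)
Lemma poly_ge0_mul_sqr p f : p != 0 -> poly_ge0 (p ^+ 2 * f) -> poly_ge0 f.
Proof.
move=> p_neq0 pf_ge0 a; rewrite leNgt; apply/negP => /poly_lt0_near[d d_gt0 dP].
(* size p points of the interval where f is negative, all of them roots of p *)
pose s := [seq a + d / k.+2%:R | k <- iota 0 (size p)].
have: (size s < size p)%N.
  apply: max_poly_roots => //; last first.
    rewrite map_inj_in_uniq ?iota_uniq // => k l _ _ /addrI /(mulfI (lt0r_neq0 d_gt0)).
    by move/invr_inj/eqP; rewrite eqr_nat => /eqP[].
  apply/allP => _ /mapP[k _ ->]; have k_gt0 : 0 < k.+2%:R :> R by rewrite ltr0n.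
  have /dP fy : `|a + d / k.+2%:R - a| < d.
    rewrite addrC addKr ger0_norm ?divr_ge0 ?ltW // ltr_pdivrMr //.
    by rewrite ltr_pMr // ltr1n.
  have := pf_ge0 (a + d / k.+2%:R); rewrite hornerM horner_exp.
  rewrite nmulr_lge0 // => py_le0.
  by apply/rootP/eqP; rewrite -sqrf_eq0 eq_le py_le0 sqr_ge0.
by rewrite size_map size_iota ltnn.
Qed.

(** The factor X - a changes sign at a, so f cannot keep a sign near a: a
root of a nonnegative polynomial is a double root. *)
Lemma poly_ge0_XsubC_root f (a : R) :
  poly_ge0 (('X - a%:P) * f) -> root f a.
Proof.
move=> f_ge0; apply/rootP/eqP; rewrite eq_le -oppr_ge0 -hornerN.
have Xa t : (('X - a%:P) * f).[t] = (t - a) * f.[t] by rewrite !hornerE.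
apply/andP; split; rewrite leNgt; apply/negP => /poly_lt0_near[d d_gt0 dP].
  have := f_ge0 (a - d / 2); have := dP (a - d / 2); rewrite hornerN Xa.
  have -> : `|a - d / 2 - a| = d / 2 by rewrite addrC addKr normrN gtr0_norm // divr_gt0.
  have d2 : d / 2 < d by lra.
  by move=> /(_ d2) ? ?; nra.
have := f_ge0 (a + d / 2); have := dP (a + d / 2); rewrite Xa.
have -> : `|a + d / 2 - a| = d / 2 by rewrite addrC addKr gtr0_norm // divr_gt0.
have d2 : d / 2 < d by lra.
by move=> /(_ d2) ? ?; nra.
Qed.

Lemma discriminant_le0 (a b c : R) :
  (forall x y, 0 <= a * x ^+ 2 + 2 * b * (x * y) + c * y ^+ 2) -> b ^+ 2 <= a * c.
Proof.
move=> H; have a_ge0 := H 1 0; have [a0|a_neq0] := eqVneq a 0.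
  have [->|b_neq0] := eqVneq b 0; first by rewrite a0 expr0n mul0r.
  have := H (- (c + 1) / (2 * b)) 1; rewrite a0 mul0r add0r expr1n !mulr1.
  by rewrite mulrC divfK ?mulf_neq0 ?pnatr_eq0 // => ?; lra.
have a_gt0 : 0 < a by rewrite lt0r a_neq0; nra.
by have := H (- b) a => ?; nra.
Qed.

End NonnegativePolynomials.

(** * Positive semidefinite matrices, real and polynomial *)

Section PsdPolynomialMatrices.

Local Open Scope ring_scope.

Variable R : rcfType.

Definition psd_mx n (A : 'M[R]_n) :=
  A^T = A /\ forall x : 'rV_n, 0 <= (x *m A *m x^T) 0 0.

Lemma psd_mx_cauchy n (A : 'M[R]_n) i j : psd_mx A -> A i j ^+ 2 <= A i i * A j j.
Proof.
case=> Asym A_ge0; apply: discriminant_le0 => x y.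
have Aji : A j i = A i j by rewrite -[in LHS]Asym mxE.
have := A_ge0 (x *: delta_mx 0 i + y *: delta_mx 0 j).
rewrite linearD !linearZ /= !trmx_delta !mulmxDl !mulmxDr -!scalemxAl -!rowE.
by rewrite -!scalemxAr -!colE !mxE Aji; congr (_ <= _); ring.
Qed.

Lemma psd_mx_diag_ge0 n (A : 'M[R]_n) i : psd_mx A -> 0 <= A i i.
Proof. by case=> _ /(_ (delta_mx 0 i)); rewrite trmx_delta -rowE -colE !mxE. Qed.

(** Elimination of the first coordinate. If the pivot is 0, so is its row, by the
Cauchy-Schwarz inequality; otherwise the Schur complement is PSD. *)
Lemma cholesky n (A : 'M[R]_n) : psd_mx A -> exists L : 'M_n, A = L *m L^T.
Proof.
elim: n A => [|n IHn] A Apsd.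
  by exists 0; apply/matrixP=> -[].
rewrite -[n.+1]/(1 + n)%N in A Apsd *.
pose a := A 0 0; pose b : 'rV_n := ursubmx A; pose D : 'M_n := drsubmx A.
have AE : A = block_mx a%:M b b^T D.
  rewrite -[LHS]submxK [ulsubmx A]mx11_scalar /b trmx_ursub Apsd.1 !mxE.
  by rewrite lshift0.
have formA (y : 'M_1) (x : 'rV_n) : 0 <=
    (y *m a%:M *m y^T + x *m b^T *m y^T + (y *m b *m x^T + x *m D *m x^T)) 0 0.
  have := Apsd.2 (row_mx y x); rewrite AE mul_row_block tr_row_mx mul_row_col.
  by rewrite !mulmxDl.
have Dsym : D^T = D by rewrite trmx_drsub Apsd.1.
have [a0|a_neq0] := eqVneq a 0.
  have b0 : b = 0.
    apply/rowP=> j; have := psd_mx_cauchy (lshift n 0) (rshift 1 j) Apsd.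
    rewrite lshift0 -/a a0 mul0r => Aj; apply/eqP.
    by rewrite !mxE -sqrf_eq0 eq_le sqr_ge0 andbT lshift0.
  have [|L DE] := IHn D.
    split=> // x; have := formA 0 x.
    by rewrite b0 trmx0 !mulmx0 !mul0mx !add0r.
  exists (block_mx 0 0 0 L); rewrite AE DE a0 b0 tr_block_mx mulmx_block.
  by rewrite !trmx0 !mulmx0 !mul0mx !add0r raddf0.
have a_gt0 : 0 < a by rewrite lt0r a_neq0 psd_mx_diag_ge0.
have [|L DE] := IHn (D - a^-1 *: (b^T *m b)).
  split=> [|x]; first by rewrite linearB linearZ /= Dsym trmx_mul trmxK.
  have := formA (- a^-1 *: (x *m b^T)) x; set y := - a^-1 *: _.
  have -> : y *m a%:M = - (x *m b^T).
    by rewrite mul_mx_scalar scalerA mulrN divff // scaleN1r.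
  rewrite mulNmx addNr add0r /y scaleNr !mulNmx -!scalemxAl mulmxBr mulmxBl.
  by rewrite -scalemxAr -scalemxAl !mulmxA addrC.
pose s := Num.sqrt a; have ss : s * s = a by rewrite -expr2 sqr_sqrtr ?ltW.
have s_neq0 : s != 0 by rewrite sqrtr_eq0 -ltNge.
exists (block_mx s%:M 0 (s^-1 *: b^T) L).
rewrite AE tr_block_mx mulmx_block !trmx0 !linearZ /= trmxK tr_scalar_mx.
rewrite !mulmx0 !mul0mx !addr0 -DE -!scalemxAl !mul_scalar_mx !mul_mx_scalar.
by rewrite scale_scalar_mx ss !scalerA mulVf // !scale1r -invfM ss addrC subrK.
Qed.

(** Quantifying over polynomial vectors, rather than evaluating G first, makes
the notion visibly invariant under change of lattice basis. *)
Definition psd_pmx n (G : 'M[{poly R}]_n) :=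
  G^T = G /\ forall v : 'rV_n, poly_ge0 ((v *m G *m v^T) 0 0).

Lemma psd_pmx_congr m n (S : 'M[{poly R}]_(m, n)) (G : 'M_n) :
  psd_pmx G -> psd_pmx (S *m G *m S^T).
Proof.
case=> Gsym G_ge0; split=> [|v]; first by rewrite !trmx_mul trmxK Gsym mulmxA.
by have := G_ge0 (v *m S); rewrite trmx_mul !mulmxA.
Qed.

Lemma psd_pmx_entry n (G : 'M[{poly R}]_n) i j : psd_pmx G -> G i j = G j i.
Proof. by case=> Gsym _; rewrite -[in LHS]Gsym mxE. Qed.

Lemma psd_pmx_eval n (G : 'M[{poly R}]_n) t :
  psd_pmx G -> psd_mx (map_mx (horner_eval t) G).
Proof.
case=> Gsym G_ge0; split=> [|x]; first by rewrite map_trmx Gsym.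
have [y <-] : exists y, map_mx (horner_eval t) y = x.
  exists (map_mx polyC x); apply/rowP=> j.
  by rewrite !mxE /horner_eval hornerC.
by rewrite map_trmx -!map_mxM [leRHS]mxE; apply: G_ge0.
Qed.

Lemma psd_pmx_cauchy n (G : 'M[{poly R}]_n) i j :
  psd_pmx G -> poly_ge0 (G i i * G j j - G i j ^+ 2).
Proof.
move=> Gpsd t; have := psd_mx_cauchy i j (psd_pmx_eval t Gpsd).
by rewrite !mxE !hornerE subr_ge0.
Qed.

Lemma psd_pmx_diag_ge0 n (G : 'M[{poly R}]_n) i : psd_pmx G -> poly_ge0 (G i i).
Proof.
by case=> _ /(_ (delta_mx 0 i)); rewrite trmx_delta -rowE -colE !mxE.
Qed.

(** By the Cauchy-Schwarz inequality, the square of G i j is dominated by 0. *)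
Lemma psd_pmx_diag0 n (G : 'M[{poly R}]_n) i j :
  psd_pmx G -> G i i = 0 -> G i j = 0.
Proof.
move=> Gpsd Gii0; have := psd_pmx_cauchy i j Gpsd; rewrite Gii0 mul0r.
move/size_sqr_le_of_dominated; rewrite size_poly0 leqn0 size_poly_eq0 sqrf_eq0.
by move/eqP.
Qed.

(** Replacing the basis vector e_i by v is a transvection 1 + e_i^T (v - e_i),
invertible because (v - e_i) e_i^T = 0. *)
Lemma row_transvection (A : comNzRingType) n (v : 'rV[A]_n) i : v 0 i = 1 ->
  exists E F : 'M_n, F *m E = 1%:M /\
    forall a, row a E = if a == i then v else delta_mx 0 a.
Proof.
move=> vi; pose e : 'rV[A]_n := delta_mx 0 i.
have [w wE] : exists w, w = v - e by exists (v - e).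
have we0 : w *m e^T = 0.
  by apply/matrixP=> a b; rewrite wE trmx_delta -colE !ord1 !mxE vi !eqxx subrr.
pose E := 1%:M + e^T *m w; pose F := 1%:M - e^T *m w.
have FE : F *m E = 1%:M.
  rewrite mulmxBl !mulmxDr !mul1mx !mulmx1 -mulmxA (mulmxA w) we0 mul0mx mulmx0.
  by rewrite addr0 addrK.
exists E, F; split=> // a.
rewrite linearD /= row1 row_mul; case: eqVneq => [->|a_neqi].
  have -> : row i e^T = 1%:M.
    by apply/matrixP=> x y; rewrite !ord1 !mxE !eqxx.
  by rewrite mul1mx wE addrC subrK.
have -> : row a e^T = 0 by apply/matrixP=> x y; rewrite !ord1 !mxE (negPf a_neqi).
by rewrite mul0mx addr0.
Qed.

(** The Gram matrix, in the basis where e_i is replaced by v / p, of the lattice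
obtained from G by adjoining v / p, when v_i = 1, v G = p u and
u v^T = p r. *)
Definition overlattice n (G : 'M[{poly R}]_n) i (u : 'rV_n) r :=
  \matrix_(a, b) if a == i then if b == i then r else u 0 b
                 else if b == i then u 0 a else G a b.

(** With E the transvection of v and D the diagonal matrix with p at place i and 1
elsewhere, E G E^T = D G' D. Hence p^2 x G' x^T is a value of the form G, so
G' is PSD. *)
Lemma overlatticeP n (G : 'M[{poly R}]_n) i (v u : 'rV_n) p r :
    psd_pmx G -> p != 0 -> v 0 i = 1 ->
    v *m G = p *: u -> (u *m v^T) 0 0 = p * r ->
  exists S k, let G' := overlattice G i u r in
    [/\ psd_pmx G', G = S *m G' *m S^T, k \is a GRing.unit & \det S = k * p].
Proof.
move=> Gpsd p_neq0 vi vG uv; set G' := overlattice G i u r.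
have [E [F [FE rowE]]] := row_transvection vi.
pose d : 'rV[{poly R}]_n := \row_a if a == i then p else 1.
pose D := diag_mx d.
have EGE : E *m G *m E^T = D *m G' *m D.
  apply/matrixP=> a b; rewrite mul_diag_mx mul_mx_diag !mxE.
  have -> : \sum_j (E *m G) a j * E^T j b = (row a E *m G *m (row b E)^T) 0 0.
    rewrite -row_mul !mxE; apply: eq_bigr => j _.
    by rewrite !mxE.
  rewrite !rowE; case: (eqVneq a i) => [_|a_neqi]; case: (eqVneq b i) => [_|b_neqi].
  - by rewrite vG -scalemxAl mxE uv mulrC.
  - by rewrite vG -scalemxAl trmx_delta -colE !mxE mulr1.
  - have Gv : G *m v^T = p *: u^T by rewrite -[G]Gpsd.1 -trmx_mul vG linearZ.
    by rewrite -mulmxA Gv -scalemxAr -matrix.rowE !mxE mul1r mulrC.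
  - by rewrite trmx_delta -matrix.rowE -colE !mxE mul1r mulr1.
exists (F *m D), (\det F); split.
- have [dsym d_ge0] := psd_pmx_congr (diag_mx (\row_a if a == i then 1 else p))
                          (psd_pmx_congr E Gpsd).
  split=> [|x]; first apply/matrixP=> a b.
    by rewrite !mxE; do 2 case: eqP => ? //; rewrite (psd_pmx_entry _ _ Gpsd).
  apply: (poly_ge0_mul_sqr p_neq0).
  have := d_ge0 x; rewrite EGE tr_diag_mx.
  set D' := diag_mx _; have D'D : D' *m D = p%:M.
    rewrite mulmx_diag; apply/matrixP=> a b; rewrite !mxE.
    by case: eqP; rewrite ?mulr1 ?mul1r.
  have DD' : D *m D' = p%:M.
    rewrite mulmx_diag; apply/matrixP=> a b; rewrite !mxE.
    by case: eqP; rewrite ?mulr1 ?mul1r.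
  rewrite !mulmxA -(mulmxA x D') D'D -(mulmxA _ D D') DD' mul_mx_scalar mul_mx_scalar.
  by rewrite -!scalemxAl !mxE expr2 mulrA.
- rewrite trmx_mul tr_diag_mx !mulmxA -[in RHS]mulmxA -(mulmxA F D) .
  rewrite -!mulmxA (mulmxA G') (mulmxA D (G' *m D)) (mulmxA D G') -EGE !mulmxA FE mul1mx.
  by rewrite -mulmxA -trmx_mul FE trmx1 mulmx1.
- by apply/unitrPr; exists (\det E); rewrite -det_mulmx FE det1.
rewrite det_mulmx det_diag; congr (_ * _).
rewrite (bigD1 i) //= mxE eqxx big1 ?mulr1 // => a /negPf a_neqi.
by rewrite mxE a_neqi.
Qed.

End PsdPolynomialMatrices.

(** * Isotropic vectors in the kernel modulo an irreducible element *)

Section IsotropicKernel.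

Local Open Scope ring_scope.

Variables (A : idomainType) (C : closedFieldType) (ev : {rmorphism A -> C}).
Variable p : A.
Hypothesis p_neq0 : p != 0.
Hypothesis ev_p : ev p = 0.
Hypothesis ev_surj : forall z, exists f, ev f = z.
Hypothesis ev_ker : forall f, ev f = 0 -> exists g, f = p * g.

Lemma lift_kernel n (G : 'M[A]_n) (z : 'rV[C]_n) : z *m map_mx ev G = 0 ->
  exists v u, [/\ map_mx ev v = z, forall j, z 0 j = 1 -> v 0 j = 1
                & v *m G = p *: u].
Proof.
move=> zG; have lift j : exists f, ev f = z 0 j /\ (z 0 j = 1 -> f = 1).
  have [->|z_neq1] := eqVneq (z 0 j) 1; first by exists 1; rewrite rmorph1.
  have [f fz] := ev_surj (z 0 j); exists f; split=> // z_eq1.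
  by rewrite z_eq1 eqxx in z_neq1.
have [f fP] := fin_all_exists lift; pose v := \row_j f j.
have ev_v : map_mx ev v = z by apply/rowP => j; rewrite !mxE (fP j).1.
have div j : exists g, (v *m G) 0 j = p * g.
  apply: ev_ker; have : map_mx ev (v *m G) 0 j = 0 by rewrite map_mxM ev_v zG mxE.
  by rewrite mxE.
have [g gP] := fin_all_exists div; exists v, (\row_j g j); split=> //.
  by move=> j z1; rewrite mxE (fP j).2.
by apply/rowP=> j; rewrite gP !mxE.
Qed.

Lemma closed_field_quadratic_root (a b c : C) : c != 0 ->
  exists s, a + s * b + s ^+ 2 * c = 0.
Proof.
move=> c_neq0; have /closed_rootP[s /rootP] : size (c *: 'X^2 + (b *: 'X + a%:P)) != 1%N.
  rewrite size_polyDl size_scale ?size_polyXn //.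
  rewrite (leq_ltn_trans (size_polyD _ _)) // gtn_max.
  rewrite (leq_ltn_trans (size_scale_leq _ _)) ?size_polyX //.
  by rewrite (leq_ltn_trans (size_polyC_leq1 _)).
rewrite !(hornerD, hornerZ, hornerC, hornerXn, hornerX) => s0.
by exists s; rewrite -[RHS]s0; ring.
Qed.

(** Start from a kernel vector z of ev G, lifted to v with v G = p u, and scaled so
that v_i = 1. Replacing row i of G by u divides det G by p, up to a unit; as p^2
divides det G, the new matrix is still singular modulo p. This gives w in
the kernel of ev G which is moreover orthogonal to ev u. If w is a multiple
of z, then z itself is isotropic for the form v G v^T / p = u v^T induced on the
kernel. Otherwise the kernel contains a plane, and a quadratic form on a plane
over an algebraically closed field has an isotropic vector. *)
Lemma isotropic_kernel n (G : 'M[A]_n) e :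
    G^T = G -> \det G = p ^+ 2 * e ->
  exists (v u : 'rV_n) i, [/\ ev (v 0 i) != 0, v *m G = p *: u & ev ((u *m v^T) 0 0) = 0].
Proof.
move=> Gsym detG.
have ev_dot (x y : 'rV[A]_n) : ev ((x *m y^T) 0 0) = (map_mx ev x *m (map_mx ev y)^T) 0 0.
  by rewrite map_trmx -map_mxM [RHS]mxE.
have evGsym : (map_mx ev G)^T = map_mx ev G by rewrite map_trmx Gsym.
have /eqP/det0P[z0 z0_neq0 z0G] : \det (map_mx ev G) = 0.
  by rewrite det_map_mx detG rmorphM rmorphXn ev_p expr0n mul0r.
have /rV0Pn[i z0i] := z0_neq0.
pose z := (z0 0 i)^-1 *: z0.
have zi : z 0 i = 1 by rewrite mxE mulVf.
have zG : z *m map_mx ev G = 0 by rewrite -scalemxAl z0G scaler0.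
have [v [u [ev_v v1 vG]]] := lift_kernel zG.
have vi := v1 i zi.
have [E [F [FE rowE]]] := row_transvection vi.
(* E replaces row i of G by v G = p u, and G1 is E G with this p removed. *)
pose G1 := \matrix_(a, b) if a == i then u 0 b else G a b.
pose d : 'rV[A]_n := \row_a if a == i then p else 1.
have EG : E *m G = diag_mx d *m G1.
  apply/row_matrixP=> a; rewrite !row_mul rowE row_diag_mx -scalemxAl -matrix.rowE mxE.
  case: eqVneq => [->|a_neqi].
    by rewrite vG; congr (_ *: _); apply/rowP=> b; rewrite !mxE eqxx.
  by rewrite -matrix.rowE scale1r; apply/rowP=> b; rewrite !mxE (negPf a_neqi).
have detG1 : p * \det G1 = p * (\det E * (p * e)).
  transitivity (\det (E *m G)); last by rewrite det_mulmx detG; ring.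
  rewrite EG det_mulmx det_diag (bigD1 i) //= mxE eqxx big1 ?mulr1 // => a /negPf a_neqi.
  by rewrite mxE a_neqi.
have /eqP/det0P[w w_neq0 wG1] : \det (map_mx ev G1)^T = 0.
  by rewrite det_tr det_map_mx (mulfI p_neq0 detG1) !rmorphM ev_p mul0r mulr0.
have wG a : a != i -> (w *m map_mx ev G) 0 a = 0.
  move=> /negPf a_neqi; have wG1a : (w *m (map_mx ev G1)^T) 0 a = 0 by rewrite wG1 mxE.
  by rewrite -[RHS]wG1a !mxE; apply: eq_bigr => b _; rewrite -evGsym !mxE a_neqi.
have wu : (w *m (map_mx ev u)^T) 0 0 = 0.
  have wG1i : (w *m (map_mx ev G1)^T) 0 i = 0 by rewrite wG1 mxE.
  by rewrite -[RHS]wG1i !mxE; apply: eq_bigr => b _; rewrite !mxE eqxx.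
(* The remaining column follows from the others, because w G z^T = 0 and z_i = 1. *)
have {}wG : w *m map_mx ev G = 0.
  apply/rowP=> a; rewrite [RHS]mxE; have [->|/wG//] := eqVneq a i.
  have : (w *m map_mx ev G *m z^T) 0 0 = 0.
    by rewrite -mulmxA -evGsym -trmx_mul zG trmx0 mulmx0 mxE.
  rewrite mxE (bigD1 i) //= big1 => [|b /wG ->]; last by rewrite mul0r.
  by rewrite addr0 [z^T _ _]mxE zi mulr1.
pose w' := w - w 0 i *: z.
have w'G : w' *m map_mx ev G = 0 by rewrite mulmxBl wG -scalemxAl zG scaler0 subr0.
have [w'0|] := eqVneq w' 0.
  have wE : w = w 0 i *: z by apply/eqP; rewrite -subr_eq0 -/w' w'0.
  exists v, u, i; split=> //; first by rewrite vi rmorph1 oner_eq0.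
  rewrite ev_dot ev_v; have wi_neq0 : w 0 i != 0.
    by apply: contra_neq w_neq0 => wi0; rewrite wE wi0 scale0r.
  apply: (mulfI wi_neq0); rewrite mulr0 -[RHS]wu [in RHS]wE -scalemxAl [RHS]mxE.
  by congr (_ * _); rewrite -[z *m _]trmxK trmx_mul trmxK [RHS]mxE.
case/rV0Pn=> j w'j.
have w'i : w' 0 i = 0 by rewrite !mxE mulVf // mulr1 subrr.
have [v' [u' [ev_v' _ v'G]]] := lift_kernel w'G.
have [C0|C_neq0] := eqVneq (ev ((u' *m v'^T) 0 0)) 0.
  by exists v', u', j; split=> //; have := w'j; rewrite -ev_v' mxE.
have [s sP] := closed_field_quadratic_root (ev ((u *m v^T) 0 0))
  (ev ((u *m v'^T) 0 0) + ev ((u' *m v^T) 0 0)) C_neq0.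
have [f fs] := ev_surj s.
exists (v + f *: v'), (u + f *: u'), i; split.
- have -> : (v + f *: v') 0 i = 1 + f * v' 0 i by rewrite !mxE vi.
  have ev0 : ev (v' 0 i) = 0 by rewrite -w'i -ev_v' mxE.
  by rewrite rmorphD rmorphM rmorph1 ev0 mulr0 addr0 oner_eq0.
- by rewrite mulmxDl vG -scalemxAl v'G scalerDr !scalerA mulrC.
rewrite linearD linearZ /= !mulmxDl !mulmxDr -!scalemxAl -!scalemxAr.
rewrite ![((_ + _)%R : 'M__) 0 0]mxE ![((_ *: _) : 'M__) 0 0]mxE !rmorphD !rmorphM fs.
by rewrite -[RHS]sP; ring.
Qed.

End IsotropicKernel.

(** * Overlattices with constant determinant *)

Section Overlattices.

Local Open Scope ring_scope.
Local Open Scope complex_scope.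

Variable R : rcfType.

Local Notation toC := (real_complex R).

Definition complex_eval (z : R[i]) : {poly R} -> R[i] :=
  horner_eval z \o map_poly toC.

HB.instance Definition _ z := GRing.RMorphism.on (complex_eval z).

(** Any kernel vector at a real point is isotropic: v G v^T is nonnegative and
vanishes there, hence to even order. *)
Lemma real_singular_isotropic n (G : 'M[{poly R}]_n) (a : R) :
    psd_pmx G -> root (\det G) a ->
  exists (v u : 'rV_n) i, [/\ coprimep ('X - a%:P) (v 0 i),
    v *m G = ('X - a%:P) *: u & 'X - a%:P %| (u *m v^T) 0 0].
Proof.
move=> Gpsd; rewrite rootE -[_.[a]]/(horner_eval a _) -det_map_mx => /det0P[z z_neq0 zG].
have /rV0Pn[i zi] := z_neq0; pose v := map_mx polyC z.
have /fin_all_exists[f fP] j : exists g, (v *m G) 0 j = ('X - a%:P) * g.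
  have: root ((v *m G) 0 j) a.
    have ev_v : map_mx (horner_eval a) v = z.
      by apply/rowP=> k; rewrite !mxE /horner_eval hornerC.
    have : map_mx (horner_eval a) (v *m G) 0 j = 0 by rewrite map_mxM ev_v zG mxE.
    by rewrite mxE => /rootP.
  by rewrite -dvdp_XsubCl => /dvdpP[g ->]; exists g; rewrite mulrC.
have vG : v *m G = ('X - a%:P) *: \row_j f j by apply/rowP=> j; rewrite fP !mxE.
exists v, (\row_j f j), i; split=> //.
  by rewrite coprimep_sym coprimep_XsubC mxE rootC.
rewrite dvdp_XsubCl; apply: poly_ge0_XsubC_root.
by have := Gpsd.2 v; rewrite vG -scalemxAl mxE.
Qed.

(** The minimal polynomial over R of a nonreal z. *)
Definition conj_quadratic (z : R[i]) : {poly R} :=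
  'X^2 - (2 * complex.Re z) *: 'X + (complex.Re z ^+ 2 + complex.Im z ^+ 2)%:P.

Lemma size_conj_quadratic z : size (conj_quadratic z) = 3%N.
Proof.
rewrite /conj_quadratic -addrA size_polyDl size_polyXn // -scaleNr.
rewrite (leq_ltn_trans (size_polyD _ _)) // gtn_max.
rewrite (leq_ltn_trans (size_scale_leq _ _)) ?size_polyX //.
by rewrite (leq_ltn_trans (size_polyC_leq1 _)).
Qed.

Lemma complex_eval_linear z (a b : R) :
  complex_eval z (a%:P + b *: 'X) = Complex (a + b * complex.Re z) (b * complex.Im z).
Proof.
rewrite -[LHS]/((map_poly toC _).[z]) rmorphD /= map_polyC map_polyZ map_polyX /=.
by rewrite !(hornerD, hornerC, hornerZ, hornerX); case: (z) => x y /=; simpc.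
Qed.

Lemma complex_eval_conj_quadratic z : complex_eval z (conj_quadratic z) = 0.
Proof.
rewrite -[LHS]/((map_poly toC _).[z]) !rmorphD !rmorphN /=.
rewrite !map_polyC map_polyZ map_polyX map_polyXn /=.
rewrite !(hornerD, hornerN, hornerC, hornerZ, hornerX, hornerXn).
case: (z) => x y; rewrite !expr2; simpc; apply/eqP.
by rewrite eq_complex /=; apply/andP; split; apply/eqP; ring.
Qed.

Lemma complex_eval_surj z (w : R[i]) : complex.Im z != 0 -> 
  exists f, complex_eval z f = w.
Proof.
move=> y_neq0.
case: w => a b; exists ((a - b / complex.Im z * complex.Re z)%:P + (b / complex.Im z) *: 'X).
by rewrite complex_eval_linear subrK divfK.
Qed.

(** The remainder of f is linear and vanishes at a nonreal point. *)
Lemma complex_eval_ker z f : complex.Im z != 0 -> complex_eval z f = 0 ->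
  exists g, f = conj_quadratic z * g.
Proof.
move=> y_neq0.
move=> f0; have : complex_eval z (f %% conj_quadratic z) = 0.
  have := f0; rewrite {1}(divp_eq f (conj_quadratic z)) rmorphD rmorphM /= .
  by rewrite complex_eval_conj_quadratic mulr0 add0r.
have r_size : (size (f %% conj_quadratic z)%R < 3)%N.
  by rewrite -(size_conj_quadratic z) ltn_modp -size_poly_gt0 size_conj_quadratic.
have rE : f %% conj_quadratic z =
    ((f %% conj_quadratic z)`_0)%:P + (f %% conj_quadratic z)`_1 *: 'X.
  apply/polyP => -[|[|k]]; rewrite coefD coefC coefZ coefX ?mulr0 ?mulr1 ?addr0 ?add0r //=.
  by rewrite nth_default // (@leq_trans 2).
rewrite rE complex_eval_linear => /eqP; rewrite eq_complex /=.
rewrite mulf_eq0 (negPf y_neq0) orbF => /andP[/eqP a0 /eqP b0].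
rewrite b0 mul0r addr0 in a0.
exists (f %/ conj_quadratic z); rewrite [LHS](divp_eq f (conj_quadratic z)) rE a0 b0 mulrC.
by rewrite scale0r !addr0.
Qed.

(** The vector is nonzero modulo p in the strong sense that one of its
coordinates is invertible modulo p; this is what lets it replace a basis
vector. *)
Lemma complex_singular_isotropic n (G : 'M[{poly R}]_n) (z : R[i]) e
    (p := conj_quadratic z) :
    G^T = G -> complex.Im z != 0 -> \det G = p ^+ 2 * e ->
  exists (v u : 'rV_n) i, [/\ coprimep p (v 0 i),
    v *m G = p *: u & p %| (u *m v^T) 0 0].
Proof.
move=> Gsym y_neq0 detG; pose ev : {rmorphism {poly R} -> R[i]} := complex_eval z.
have p_neq0 : p != 0 by rewrite -size_poly_gt0 size_conj_quadratic.
have ev_p : ev p = 0 := complex_eval_conj_quadratic z.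
have ev_surj w := complex_eval_surj w y_neq0.
have ev_ker f := @complex_eval_ker z f y_neq0.
have [v [u [i [vi vG uv]]]] := isotropic_kernel p_neq0 ev_p ev_surj ev_ker Gsym detG.
have [g gP] := ev_ker _ uv.
exists v, u, i; split=> //; last by rewrite gP dvdp_mulr.
have [s sv] : exists s, ev s = (ev (v 0 i))^-1 by exact: ev_surj.
have [h hP] : exists h, s * v 0 i - 1 = p * h.
  by apply: ev_ker; rewrite rmorphB rmorphM rmorph1 sv mulVf ?subrr.
by apply/Bezout_eq1_coprimepP; exists (- h, s); rewrite /= mulNr mulrC -hP opprB subrK.
Qed.


Lemma isotropic_at_divisor n (G : 'M[{poly R}]_n) c :
    psd_pmx G -> \det G = c ^+ 2 -> c != 0 -> (1 < size c)%N ->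
  exists (p : {poly R}) (v u : 'rV_n) i, [/\ (1 < size p)%N /\ p %| c, coprimep p (v 0 i),
    v *m G = p *: u & p %| (u *m v^T) 0 0].
Proof.
move=> Gpsd detG c_neq0 c_size.
have /closed_rootP[z cz] : size (map_poly toC c) != 1%N by rewrite size_map_poly gtn_eqF.
have [y0|y_neq0] := eqVneq (complex.Im z) 0.
  have ca : root c (complex.Re z).
    move: cz; rewrite (_ : z = toC (complex.Re z)) ?fmorph_root //.
    by case: (z) y0 => x y /= ->.
  have Ga : root (\det G) (complex.Re z) by rewrite detG expr2 rootM ca.
  have [v [u [i [vi vG uv]]]] := real_singular_isotropic Gpsd Ga.
  exists ('X - (complex.Re z)%:P), v, u, i; split=> //.
  by rewrite size_XsubC dvdp_XsubCl.
have [e cE] := complex_eval_ker y_neq0 (rootP cz).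
have detG' : \det G = (conj_quadratic z) ^+ 2 * e ^+ 2 by rewrite detG cE exprMn.
have [v [u [i [vi vG uv]]]] := complex_singular_isotropic Gpsd.1 y_neq0 detG'.
exists (conj_quadratic z), v, u, i; split=> //.
by rewrite size_conj_quadratic cE dvdp_mulr.
Qed.

(** A Bezout relation a p + b v_i = 1 turns v into a vector congruent to b v
modulo p and whose i-th coordinate is exactly 1. *)
Lemma overlattice_step n (G : 'M[{poly R}]_n) p (v u : 'rV_n) i :
    psd_pmx G -> p != 0 -> coprimep p (v 0 i) ->
    v *m G = p *: u -> p %| (u *m v^T) 0 0 ->
  exists (S G' : 'M_n) k, [/\ psd_pmx G', G = S *m G' *m S^T,
    k \is a GRing.unit & \det S = k * p].
Proof.
move=> Gpsd p_neq0 /Bezout_eq1_coprimepP[[a b] /= ab1] vG /dvdpP[g uv].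
pose w := b *: v + (a * p) *: delta_mx 0 i.
have wi : w 0 i = 1 by rewrite !mxE !eqxx mulr1 addrC.
have wG : w *m G = p *: (b *: u + a *: row i G).
  by rewrite mulmxDl -!scalemxAl vG -rowE scalerDr !scalerA (mulrC b) (mulrC a).
have Gv : (row i G *m v^T) 0 0 = p * u 0 i.
  rewrite -row_mul -[G]Gpsd.1 -trmx_mul vG !mxE; ring.
have uw : ((b *: u + a *: row i G) *m w^T) 0 0
    = p * (b ^+ 2 * g + 2 * a * b * u 0 i + a ^+ 2 * G i i).
  rewrite linearD !linearZ /= trmx_delta mulmxDl !mulmxDr -!scalemxAl -!scalemxAr -!colE.
  rewrite ![((_ + _)%R : 'M__) 0 0]mxE ![((_ *: _) : 'M__) 0 0]mxE uv Gv !mxE; ring.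
have [S [k [G'psd GE k_unit detS]]] := overlatticeP Gpsd p_neq0 wi wG uw.
by exists S, (overlattice G i (b *: u + a *: row i G)
  (b ^+ 2 * g + 2 * a * b * u 0 i + a ^+ 2 * G i i)), k.
Qed.

(** Each step divides det G by p^2, up to a unit, and so keeps it a square. *)
Lemma maximal_overlattice n (G : 'M[{poly R}]_n) c :
    psd_pmx G -> \det G = c ^+ 2 -> c != 0 ->
  exists S G' : 'M_n, [/\ psd_pmx G', G = S *m G' *m S^T & size (\det G') = 1%N].
Proof.
have [m] := ubnP (size c); elim: m => // m IHm in G c *.
rewrite ltnS => c_size Gpsd detG c_neq0.
have [c1|c_neq1] := eqVneq (size c) 1%N.
  have [a a_neq0 ca] := size_poly1P _ (introT eqP c1).
  exists 1%:M, G; split; rewrite ?mul1mx ?trmx1 ?mulmx1 //.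
  by rewrite detG ca -rmorphXn /= size_polyC expf_neq0.
have c_gt1 : (1 < size c)%N by rewrite ltn_neqAle eq_sym c_neq1 size_poly_gt0.
have [p [v [u [i [[p_size p_dvd] vi vG uv]]]]] :=
  isotropic_at_divisor Gpsd detG c_neq0 c_gt1.
have p_neq0 : p != 0 by rewrite -size_poly_gt0 ltnW.
have [S [G' [k [G'psd GE k_unit detS]]]] := overlattice_step Gpsd p_neq0 vi vG uv.
have /dvdpP[e cE] := p_dvd.
have k_neq0 : k != 0 by apply: contraTneq k_unit => ->; rewrite unitr0.
have e_neq0 : e != 0 by apply: contra_neq c_neq0 => e0; rewrite cE e0 mul0r.
have detG' : \det G' = (k^-1 * e) ^+ 2.
  have : (k * p) ^+ 2 * \det G' = (k * p) ^+ 2 * (k^-1 * e) ^+ 2.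
    rewrite -[RHS]exprMn mulrACA mulrV // mul1r [p * e]mulrC -cE -detG.
    by rewrite GE !det_mulmx det_tr detS; ring.
  by move/(mulfI (expf_neq0 2 (mulf_neq0 k_neq0 p_neq0))).
have k'_size : size k^-1 = 1%N.
  by apply/eqP; have := unitrV k; rewrite k_unit poly_unitE => /andP[].
have k'_neq0 : k^-1 != 0 by rewrite -size_poly_gt0 k'_size.
have e_size : (size (k^-1 * e)%R < m)%N.
  rewrite size_mul // k'_size; apply: leq_trans c_size.
  rewrite cE size_mul // add1n /=; case: (size p) p_size => [|[|q]] // _.
  by rewrite !addnS /= ltnS leq_addr.
have [S' [G'' [G''psd G'E detG'']]] :=
  IHm _ _ e_size G'psd detG' (mulf_neq0 k'_neq0 e_neq0).
exists (S *m S'), G''; split=> //.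
by rewrite GE G'E trmx_mul !mulmxA.
Qed.

End Overlattices.

(** * Reduction of the degrees of a basis *)

Section DegreeReduction.

Local Open Scope ring_scope.

Variable R : rcfType.

Definition half_degree n (G : 'M[{poly R}]_n) i := ((size (G i i)).-1)./2.

(** The entry G i j has degree at most d_i + d_j by the Cauchy-Schwarz
inequality, so this is the limit of the matrix (t^(- d_i - d_j) G i j) as t
tends to infinity. *)
Definition leading_mx n (G : 'M[{poly R}]_n) : 'M[R]_n :=
  \matrix_(i, j) (G i j)`_(half_degree G i + half_degree G j).

Lemma size_psd_diag n (G : 'M[{poly R}]_n) i : psd_pmx G -> G i i != 0 ->
  size (G i i) = (half_degree G i).*2.+1.
Proof.
move=> Gpsd Gii; have := poly_ge0_odd_size (psd_pmx_diag_ge0 i Gpsd) Gii.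
rewrite /half_degree; case: (size _) => //= s s_even.
by rewrite even_halfK.
Qed.

Lemma size_psd_entry n (G : 'M[{poly R}]_n) i j :
    psd_pmx G -> G i i != 0 -> G j j != 0 ->
  (size (G i j) <= (half_degree G i + half_degree G j).+1)%N.
Proof.
move=> Gpsd Gii Gjj; have [->|Gij] := eqVneq (G i j) 0; first by rewrite size_poly0.
have := size_sqr_le_of_dominated (psd_pmx_cauchy i j Gpsd).
rewrite expr2 !size_mul // (size_psd_diag Gpsd Gii) (size_psd_diag Gpsd Gjj).
by move: (half_degree G i) (half_degree G j) (size _) => a b s; lia.
Qed.

Lemma coef_top_mul (f g : {poly R}) a b : (size f <= a.+1)%N -> (size g <= b.+1)%N ->
  (f * g)`_(a + b) = f`_a * g`_b.
Proof.
move=> sf sg; rewrite coefM; have lt_a : (a < (a + b).+1)%N by rewrite ltnS leq_addr.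
rewrite (bigD1 (Ordinal lt_a)) //= addKn big1 ?addr0 // => i i_neq.
have [lt_ia|le_ai] := ltnP i a.
  by rewrite [g`__]nth_default ?mulr0 // (leq_trans sg) //; lia.
rewrite nth_default ?mul0r // (leq_trans sf) // ltn_neqAle le_ai andbT eq_sym.
by apply: contra_neq i_neq => ia; apply: val_inj.
Qed.

Lemma coef_top_prod (I : Type) (r : seq I) (F : I -> {poly R}) e :
    (forall i, (size (F i) <= (e i).+1)%N) ->
  (size (\prod_(i <- r) F i)%R <= (\sum_(i <- r) e i).+1)%N /\
  (\prod_(i <- r) F i)`_(\sum_(i <- r) e i) = \prod_(i <- r) (F i)`_(e i).
Proof.
move=> Fe; elim: r => [|i r [IHs IHc]]; first by rewrite !big_nil size_poly1 coef1.
rewrite !big_cons coef_top_mul // IHc; split=> //.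
by have := size_polyMleq (F i) (\prod_(j <- r) F j); have := Fe i; lia.
Qed.

Lemma coef_det_leading n (G : 'M[{poly R}]_n) : psd_pmx G -> (forall i, G i i != 0) ->
  (\det G)`_(\sum_i (half_degree G i).*2) = \det (leading_mx G).
Proof.
move=> Gpsd Gii; rewrite coef_sum; apply: eq_bigr => s _.
have -> : (\sum_i (half_degree G i).*2 =
    \sum_i (half_degree G i + half_degree G (s i)))%N.
  rewrite [RHS]big_split /=.
  have <- : (\sum_i half_degree G i = \sum_i half_degree G (s i))%N.
    exact: (reindex_inj (@perm_inj _ s)).
  by under eq_bigr do rewrite -addnn; rewrite !big_split.
have [_ coefE] := coef_top_prod (index_enum _)
  (fun i => size_psd_entry Gpsd (Gii i) (Gii (s i))).
rewrite !mulr_sign (fun_if (fun f : {poly R} => f`_ _)) coefN coefE.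
by under [in RHS]eq_bigr do rewrite mxE.
Qed.

(** For h in the kernel of the leading matrix, choose i of maximal half degree
with h_i nonzero and replace e_i by the sum of the h_j t^(d_i - d_j) e_j,
scaled by 1 / h_i: the coefficient of degree 2 d_i of its norm is a multiple
of h H h^T = 0, where H is the leading matrix. *)
Lemma degree_reduction_step n (G : 'M[{poly R}]_n) :
    psd_pmx G -> (forall i, G i i != 0) -> \det (leading_mx G) = 0 ->
  exists S G' : 'M_n, [/\ psd_pmx G', G = S *m G' *m S^T, \det S != 0
    & (\sum_i size (G' i i) < \sum_i size (G i i))%N].
Proof.
move=> Gpsd Gii /eqP/det0P[h /rV0Pn[i0 hi0] hH]; pose d := half_degree G.
have [i hi i_max] := @arg_maxnP _ i0 (fun j => h 0 j != 0) d hi0.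
pose c j := h 0 j / h 0 i; pose v : 'rV_n := \row_j ((c j)%:P * 'X^(d i - d j)).
have vi : v 0 i = 1 by rewrite mxE /c divff // subnn expr0 mulr1.
pose u := v *m G; pose r := (u *m v^T) 0 0.
have coef_r e : r`_((d i).*2 + e) = \sum_k (\sum_j c j * (G j k)`_(d j + d k + e)) * c k.
  rewrite /r mxE coef_sum; apply: eq_bigr => k _.
  rewrite mxE mulr_suml coef_sum mulr_suml; apply: eq_bigr => j _.
  rewrite !mxE; have [hj0|hj] := eqVneq (h 0 j) 0.
    by rewrite /c hj0 !mul0r coef0.
  have [hk0|hk] := eqVneq (h 0 k) 0.
    by rewrite /c hk0 !(mul0r, mulr0) coef0.
  have -> : (c j)%:P * 'X^(d i - d j) * G j k * ((c k)%:P * 'X^(d i - d k))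
    = (c j)%:P * (((c k)%:P * (G j k)) * 'X^((d i - d j) + (d i - d k))).
    by rewrite exprD; ring.
  rewrite coefCM coefMXn coefCM.
  have dk : (d k <= d i)%N := i_max k hk; have dj : (d j <= d i)%N := i_max j hj.
  have le_jk : (d i - d j + (d i - d k) <= (d i).*2 + e)%N by lia.
  rewrite ltnNge le_jk /=.
  rewrite [RHS]mulrAC -mulrA; congr (_ * (_ * nth _ _ _)); lia.
have r_size : (size r < size (G i i))%N.
  rewrite (size_psd_diag Gpsd) // ltnS; apply/leq_sizeP => m le_m.
  rewrite -(subnKC le_m) coef_r; case: (m - _)%N => [|e].
    apply: big1 => k _; rewrite (_ : \sum_j _ = 0) ?mul0r //.
    transitivity ((h 0 i)^-1 * (h *m leading_mx G) 0 k); last by rewrite hH mxE mulr0.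
    rewrite mxE mulr_sumr; apply: eq_bigr => j _.
    by rewrite /c mxE addn0 mulrAC mulrC.
  apply: big1 => k _; rewrite big1 ?mul0r // => j _.
  rewrite nth_default ?mulr0 // (leq_trans (size_psd_entry Gpsd (Gii j) (Gii k))) //.
  by rewrite addnS ltnS leq_addr.
have vG : v *m G = 1 *: u by rewrite scale1r.
have uv : (u *m v^T) 0 0 = 1 * r by rewrite mul1r.
have [S [k [G'psd GE k_unit detS]]] := overlatticeP Gpsd (oner_neq0 _) vi vG uv.
exists S, (overlattice G i u r); split=> //.
  by rewrite detS mulr1; apply: contraTneq k_unit => ->; rewrite unitr0.
rewrite (bigD1 i) //= [ltnRHS](bigD1 i) //= mxE eqxx -addSn leq_add //.
by apply: leq_sum => a /negPf a_neqi; rewrite mxE a_neqi.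
Qed.

Lemma degree_reduction n (G : 'M[{poly R}]_n) : psd_pmx G ->
  exists S G' : 'M_n, [/\ psd_pmx G', G = S *m G' *m S^T, \det S != 0
    & (exists i, G' i i = 0) \/
      (forall i, G' i i != 0) /\ \det (leading_mx G') != 0].
Proof.
have [m] := ubnP (\sum_i size (G i i)); elim: m => // m IHm in G *.
rewrite ltnS => le_m Gpsd.
have [/existsP[i /eqP Gii0]|/existsPn Gii] := boolP [exists i, G i i == 0].
  exists 1%:M, G; split; rewrite ?mul1mx ?trmx1 ?mulmx1 ?det1 ?oner_eq0 //.
  by left; exists i.
have [H0|H_neq0] := eqVneq (\det (leading_mx G)) 0; last first.
  by exists 1%:M, G; split; rewrite ?mul1mx ?trmx1 ?mulmx1 ?det1 ?oner_eq0 //; right.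
have [S [G' [G'psd GE S_neq0 lt_m]]] := degree_reduction_step Gpsd Gii H0.
have [S' [G'' [G''psd G'E S'_neq0 H]]] := IHm _ (leq_trans lt_m le_m) G'psd.
exists (S *m S'), G''; split=> //; last by rewrite det_mulmx mulf_neq0.
by rewrite GE G'E trmx_mul !mulmxA.
Qed.

End DegreeReduction.

(** * Factorization of PSD polynomial matrices *)

Section SumsOfSquares.

Local Open Scope ring_scope.

Variable R : rcfType.

Lemma psd_pmx_det_ge0 n (G : 'M[{poly R}]_n) : psd_pmx G -> poly_ge0 (\det G).
Proof.
move=> Gpsd t; have [L GE] := cholesky (psd_pmx_eval t Gpsd).
by rewrite -[_.[t]]/(horner_eval t _) -det_map_mx GE det_mulmx det_tr -expr2 sqr_ge0.
Qed.

Lemma psd_pmx_det0 n (G : 'M[{poly R}]_n) i : psd_pmx G -> G i i = 0 -> \det G = 0.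
Proof.
move=> Gpsd Gii; apply/eqP/det0P; exists (delta_mx 0 i).
  by apply/eqP => /rowP/(_ i)/eqP; rewrite !mxE !eqxx oner_eq0.
by apply/rowP=> j; rewrite -rowE !mxE psd_pmx_diag0.
Qed.

(** After reduction the determinant has degree the sum of the 2 d_i; as it is
constant, all the entries are constant. *)
Lemma unimodular_factorization n (G : 'M[{poly R}]_n) :
  psd_pmx G -> size (\det G) = 1%N -> exists N : 'M_n, G = N *m N^T.
Proof.
move=> Gpsd detG; have [S [G' [G'psd GE S_neq0 H]]] := degree_reduction Gpsd.
have detG' : \det G' != 0.
  apply: contra_eqN detG; rewrite GE !det_mulmx => /eqP->.
  by rewrite mulr0 mul0r size_poly0.
have detG'_size : (size (\det G') <= 1)%N.
  move: detG; rewrite GE !det_mulmx det_tr !size_mul ?mulf_neq0 //.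
  have := S_neq0; have := detG'; rewrite -!size_poly_gt0.
  by move: (size _) (size _) => a b; lia.
case: H => [[i G'ii]|[G'ii H_neq0]].
  by rewrite (psd_pmx_det0 G'psd G'ii) eqxx in detG'.
have d0 i : half_degree G' i = 0%N.
  suff : ((half_degree G' i).*2 < size (\det G'))%N.
    by move: (size _) detG'_size (half_degree G' i) => a ? b; lia.
  rewrite ltnNge; apply: contra H_neq0 => le_d.
  rewrite -coef_det_leading // nth_default // (leq_trans le_d) //.
  by rewrite (bigD1 i) //= leq_addr.
have G'const : G' = map_mx polyC (map_mx (horner_eval 0) G').
  apply/matrixP=> i j; rewrite !mxE /horner_eval horner_coef0 -size1_polyC //.
  by have := size_psd_entry G'psd (G'ii i) (G'ii j); rewrite !d0.
have [L LE] := cholesky (psd_pmx_eval 0 G'psd).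
exists (S *m map_mx polyC L).
by rewrite GE G'const LE map_mxM trmx_mul map_trmx !mulmxA.
Qed.

(** The extra basis vector of norm det M makes the determinant a square, at the
cost of one more square in the representation of M. *)
Lemma nonsingular_factorization n (M : 'M[{poly R}]_n) : psd_pmx M -> \det M != 0 ->
  exists N : 'M_(n, n.+1), M = N *m N^T.
Proof.
move=> Mpsd detM; pose G : 'M_(1 + n) := block_mx (\det M)%:M 0 0 M.
have Gpsd : psd_pmx G.
  split=> [|v t]; first by rewrite tr_block_mx !trmx0 tr_scalar_mx Mpsd.1.
  rewrite -[v]hsubmxK mul_row_block tr_row_mx mul_row_col !mulmx0 addr0 add0r.
  rewrite [lsubmx v]mx11_scalar -scalar_mxM tr_scalar_mx -scalar_mxM mxE hornerD.
  rewrite addr_ge0 ?Mpsd.2 // mxE eqxx mulr1n mulrAC -expr2 hornerM horner_exp.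
  by rewrite mulr_ge0 ?sqr_ge0 // psd_pmx_det_ge0.
have detG : \det G = (\det M) ^+ 2 by rewrite det_ublock det_scalar1 expr2.
have [S [G' [G'psd GE detG']]] := maximal_overlattice Gpsd detG detM.
have [N NE] := unimodular_factorization G'psd detG'.
exists (dsubmx (S *m N : 'M_(1 + n, n.+1))).
have : G = (S *m N) *m (S *m N)^T by rewrite GE NE trmx_mul !mulmxA.
rewrite -[S *m N]vsubmxK tr_col_mx mul_col_row => /eq_block_mx[_ _ _].
by rewrite col_mxKd.
Qed.

Theorem psd_pmx_factorization n (M : 'M[{poly R}]_n) : psd_pmx M ->
  exists N : 'M_(n, n.+1), M = N *m N^T.
Proof.
elim: n M => [|n IHn] M Mpsd; first by exists 0; apply/matrixP=> -[].
have [detM|/(nonsingular_factorization Mpsd)//] := eqVneq (\det M) 0.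
have [S [M' [M'psd ME S_neq0 H]]] := degree_reduction Mpsd.
have detM' : \det M' = 0.
  move/eqP: detM; rewrite ME !det_mulmx det_tr !mulf_eq0 (negPf S_neq0) orbF.
  by move/eqP.
case: H => [[i M'ii]|[M'ii]]; last first.
  by rewrite -coef_det_leading // detM' coef0 eqxx.
(* J deletes the zero coordinate i. *)
pose J : 'M[{poly R}]_(n, n.+1) := \matrix_(a, b) (lift i a == b)%:R.
have JJ : J^T *m J = 1%:M - delta_mx i i.
  apply/matrixP=> a b; rewrite !mxE; case: (unliftP i a) => [a' ->|->].
    rewrite (bigD1 a') //= !mxE eqxx mul1r big1 ?addr0 => [|k k_neq].
      by rewrite (eq_sym _ i) (negPf (neq_lift _ _)) subr0.
    by rewrite !mxE (inj_eq lift_inj) (negPf k_neq) mul0r.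
  rewrite big1 => [|k _]; first by rewrite eqxx eq_sym subrr.
  by rewrite !mxE eq_sym (negPf (neq_lift _ _)) mul0r.
have M'J : M' *m (J^T *m J) = M'.
  rewrite JJ mulmxBr mulmx1 [X in _ - X](_ : _ = 0) ?subr0 //.
  apply/matrixP=> a b; rewrite !mxE big1 // => k _; rewrite mxE.
  case: eqVneq => [->|_]; last by rewrite mulr0.
  by rewrite (psd_pmx_entry _ _ M'psd) psd_pmx_diag0 // mul0r.
have [N NE] := IHn _ (psd_pmx_congr J M'psd).
(* The rank dropped by one, so a zero column is needed to reach n + 2 columns. *)
pose N' : 'M_(n.+1, 1 + n.+1) := row_mx (0 : 'M_(_, 1)) (J^T *m N).
exists (S *m N').
have M'E : M' = N' *m N'^T.
  rewrite tr_row_mx mul_row_col mul0mx add0r trmx_mul trmxK.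
  rewrite mulmxA -(mulmxA _ N) -NE -[LHS]M'J -[in LHS]M'psd.1 -[in LHS]M'J.
  by rewrite trmx_mul M'psd.1 trmx_mul trmxK !mulmxA.
by rewrite ME {1}M'E trmx_mul !mulmxA.
Qed.

End SumsOfSquares.

(** * Biquadratic forms and their coefficients *)

Section BiquadraticForms.

Local Open Scope ring_scope.

Variables (R : realType) (m n : nat).

Local Notation xvar := (@xvar R m n).
Local Notation yvar := (@yvar R m n).

Definition biquadratic (b : 'I_m -> 'I_m -> 'I_n -> 'I_n -> R) : bipoly R m n :=
  \sum_(i < m) \sum_(k < m) \sum_(j < n) \sum_(l < n)
    b i k j l *: (xvar i * xvar k * yvar j * yvar l).

Definition biquadratic_mnm (q : 'I_m * 'I_m * ('I_n * 'I_n)) : 'X_{1..m + n} :=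
  (U_(@xidx m n q.1.1) + U_(@xidx m n q.1.2) +
   U_(@yidx m n q.2.1) + U_(@yidx m n q.2.2))%MM.

Lemma biquadratic_mnmE b : biquadratic b =
  \sum_q b q.1.1 q.1.2 q.2.1 q.2.2 *: 'X_[biquadratic_mnm q].
Proof.
rewrite /biquadratic; under eq_bigr do under eq_bigr do rewrite pair_bigA /=.
rewrite pair_bigA pair_bigA /=.
by apply: eq_bigr => -[[i k] [j l]] _; rewrite !mpolyXD.
Qed.

(** The coefficient of each monomial is shared equally between all the indices
that produce this monomial. *)
Lemma monomial_sum_normalization (Q : finType) (e : Q -> 'X_{1..m + n}) (a : Q -> R)
    (P := \sum_q a q *: 'X_[e q] : bipoly R m n) :
  P = \sum_q (P@_(e q) / #|[pred q' | e q' == e q]|%:R) *: 'X_[e q].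
Proof.
have coefP t : P@_t = \sum_(q | e q == t) a q.
  rewrite raddf_sum [RHS]big_mkcond; apply: eq_bigr => q _.
  by rewrite /= mcoeffZ mcoeffX; case: eqP; rewrite ?mulr1 ?mulr0.
pose card q : R := #|[pred q' | e q' == e q]|%:R.
have card_neq0 q : card q != 0.
  by rewrite pnatr_eq0 -lt0n; apply/card_gt0P; exists q; rewrite inE.
transitivity (\sum_q \sum_(q' | e q' == e q) ((a q' / card q') *: 'X_[e q'] : bipoly R m n)).
  rewrite (exchange_big_dep xpredT) //=; apply: eq_bigr => q' _.
  under eq_bigl do rewrite eq_sym.
  by rewrite sumr_const -scaler_nat scalerA mulrC divfK.
apply: eq_bigr => q _; rewrite coefP mulr_suml scaler_suml.
apply: eq_bigr => q' /eqP eq_q.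
by rewrite /card eq_q.
Qed.

(** The coefficients of a biquadratic form are not determined by the
polynomial; the equal sharing makes them symmetric and makes them vanish
outside the support of P. *)
Lemma biquadratic_normal_form (P : bipoly R m n) : biquadratic_form P ->
  exists b, [/\ P = biquadratic b,
    forall i k j l, b i k j l = b k i j l,
    forall i k j l, b i k j l = b i k l j &
    forall i k j l, b i k j l != 0 -> biquadratic_mnm (i, k, (j, l)) \in msupp P].
Proof.
case=> a; rewrite -/(biquadratic a) => PE.
pose w q := P@_(biquadratic_mnm q) /
  #|[pred q' | biquadratic_mnm q' == biquadratic_mnm q]|%:R.
have w_eq q q' : biquadratic_mnm q = biquadratic_mnm q' -> w q = w q'.
  by rewrite /w => ->.
exists (fun i k j l => w (i, k, (j, l))); split=> [|i k j l|i k j l|i k j l].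
- rewrite biquadratic_mnmE [LHS]PE biquadratic_mnmE monomial_sum_normalization.
  apply: eq_bigr => -[[i k] [j l]] _; congr (_ *: _).
  by rewrite /w PE biquadratic_mnmE.
- by apply: w_eq; rewrite /biquadratic_mnm /= [(U_(@xidx m n i) + _)%MM]addmC.
- by apply: w_eq; rewrite /biquadratic_mnm /= -!addmA [(U_(@yidx m n j) + _)%MM]addmC.
by rewrite mcoeff_msupp; apply: contra_neq; rewrite /w => ->; rewrite mul0r.
Qed.

Lemma meval_biquadratic b (x : 'rV[R]_m) (y : 'rV[R]_n) :
  (biquadratic b).@[row_mx x y 0] =
  \sum_i \sum_k x 0 i * x 0 k * \sum_j \sum_l b i k j l * (y 0 j * y 0 l).
Proof.
rewrite raddf_sum; apply: eq_bigr => i _; rewrite raddf_sum; apply: eq_bigr => k _.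
rewrite raddf_sum mulr_sumr; apply: eq_bigr => j _.
rewrite raddf_sum mulr_sumr; apply: eq_bigr => l _.
rewrite /= mevalZ !mevalM !mevalXU !row_mxEl !row_mxEr; ring.
Qed.

Lemma biquadratic_sym_eq b b' :
    (forall i k j l, b i k j l + b i k l j = b' i k j l + b' i k l j) ->
  biquadratic b = biquadratic b'.
Proof.
move=> bb'; have double c : 2 *: biquadratic c =
    biquadratic (fun i k j l => c i k j l + c i k l j).
  rewrite scaler_nat mulr2n -!big_split; apply: eq_bigr => i _.
  rewrite -!big_split; apply: eq_bigr => k _.
  rewrite /= [X in _ + X = _]exchange_big -!big_split; apply: eq_bigr => j _.
  rewrite -!big_split; apply: eq_bigr => l _; rewrite scalerDl; congr (_ + _ *: _).
  by rewrite -!mulrA [yvar l * _]mulrC.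
have two_neq0 : 2 != 0 :> R by rewrite pnatr_eq0.
apply: (scalerI two_neq0); rewrite !double.
by do 4 (apply: eq_bigr => ? _); rewrite bb'.
Qed.

Lemma sum_sqr_bilinear r (c : 'I_r -> 'M[R]_(m, n)) :
  \sum_(s < r) bilinear_form (c s) ^+ 2 =
  biquadratic (fun i k j l => \sum_(s < r) c s i j * c s k l).
Proof.
transitivity (\sum_(s < r) biquadratic (fun i k j l => c s i j * c s k l)).
  apply: eq_bigr => s _; rewrite expr2 mulr_suml; apply: eq_bigr => i _.
  rewrite mulr_sumr; apply: eq_bigr => k _; rewrite mulr_suml.
  apply: eq_bigr => j _; rewrite mulr_sumr; apply: eq_bigr => l _.
  by rewrite -scalerAl -scalerAr scalerA mulrACA !mulrA.
rewrite exchange_big; apply: eq_bigr => i _.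
rewrite exchange_big; apply: eq_bigr => k _.
rewrite exchange_big; apply: eq_bigr => j _.
rewrite exchange_big; apply: eq_bigr => l _.
by rewrite -scaler_suml.
Qed.

Lemma sos_rank_le_of_sum_of_squares r (P : bipoly R m n) :
  sum_of_squares r P -> sos_rank_le P r.
Proof.
move=> Pr; have exP : exists r, `[< sum_of_squares r P >] by exists r; apply/asboolP.
have [k /asboolP Pk k_min] := ex_minnP exP.
exists k; split; last exact/k_min/asboolP.
by split=> // s Ps; apply/k_min/asboolP.
Qed.

End BiquadraticForms.

(** * Forms in three y-variables deficient in the last one *)

Section YDeficient.

Local Open Scope ring_scope.

Variable R : realType.

(** No cancellation of leading terms is possible in the sums of squares on the
diagonal of N N^T, so N has degree at most 1. *)
Lemma linear_factorization n (M : 'M[{poly R}]_n) :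
    psd_pmx M -> (forall i, (size (M i i) <= 3)%N) ->
  exists C D : 'M[R]_(n, n.+1),
    let N := map_mx polyC C + 'X *: map_mx polyC D in M = N *m N^T.
Proof.
move=> Mpsd M_size; have [N MN] := psd_pmx_factorization Mpsd.
have N_size i s : (size (N i s) <= 2)%N.
  have : poly_ge0 (M i i - N i s ^+ 2).
    move=> t; rewrite MN mxE (bigD1 s) //= mxE expr2 addrC addrK horner_sum.
    by apply: sumr_ge0 => k _; rewrite mxE hornerM -expr2 sqr_ge0.
  move/size_sqr_le_of_dominated/leq_trans/(_ (M_size i)).
  have := size_exp (N i s) 2; move: (size _) (size _) => a b; lia.
exists (\matrix_(i, s) (N i s)`_0), (\matrix_(i, s) (N i s)`_1).
rewrite {1}MN; suff <- : N = map_mx polyC (\matrix_(i, s) (N i s)`_0)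
    + 'X *: map_mx polyC (\matrix_(i, s) (N i s)`_1) by [].
apply/matrixP=> i s; rewrite !mxE; apply/polyP => -[|[|k]].
- by rewrite coefD coefC coefXM addr0.
- by rewrite coefD coefC coefXM coefC add0r.
by rewrite coefD coefC coefXM coefC addr0 nth_default // (leq_trans (N_size i s)).
Qed.

Let y0 : 'I_3 := 0.
Let y1 : 'I_3 := 1.
Let y2 : 'I_3 := ord_max.

(** The first m + 1 bilinear forms come from the columns of the factor of
M(t) = Q(., (1, t)), the last m are the sqrt(d_r) x_r y_3. *)
Lemma sum_of_squares_y_deficient m (P : bipoly R m 3) :
    biquadratic_form P -> psd P -> y_deficient_in (ord_max : 'I_3) P ->
  sum_of_squares (m.+1 + m) P.
Proof.
move=> /biquadratic_normal_form[b [PE b_x b_y b_supp]] Ppsd Pdef.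
have b_y2 i k j : ~~ ((i == k) && (j == y2)) -> b i k j y2 = 0.
  move=> ne; have [//|/b_supp t_supp] := eqVneq (b i k j y2) 0.
  have [|t_y t_x] := Pdef _ t_supp; first by rewrite !mnmDE !mnm1E eqxx addn1.
  case/negP: ne; apply/andP; split.
    by apply/negPn/negP => /t_x; apply; split; rewrite !mnmDE !mnm1E eqxx; lia.
  apply/negPn/negP => /t_y; rewrite !mnmDE !mnm1E eqxx; lia.
have form_ge0 (x : 'rV[R]_m) (y : 'rV[R]_3) :
    0 <= \sum_i \sum_k x 0 i * x 0 k * \sum_j \sum_l b i k j l * (y 0 j * y 0 l).
  by rewrite -meval_biquadratic -PE.
have d_ge0 r : 0 <= b r r y2 y2.
  have := form_ge0 (delta_mx 0 r) (delta_mx 0 y2).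
  rewrite (bigD1 r) //= [X in _ + X]big1 ?addr0 => [|i i_neq]; last first.
    by rewrite big1 // => k _; rewrite !mxE (negPf i_neq) andbF !mul0r.
  rewrite (bigD1 r) //= [X in _ + X]big1 ?addr0 => [|k k_neq]; last first.
    by rewrite !mxE (negPf k_neq) andbF mulr0 mul0r.
  rewrite (bigD1 y2) //= [X in _ * (_ + X)]big1 ?addr0 => [|j j_neq]; last first.
    by rewrite big1 // => l _; rewrite !mxE (negPf j_neq) andbF mul0r mulr0.
  rewrite (bigD1 y2) //= [X in _ * (_ + X)]big1 ?addr0 => [|l l_neq]; last first.
    by rewrite !mxE (negPf l_neq) andbF !mulr0.
  by rewrite !mxE !eqxx !mulr1 mul1r.
pose M : 'M[{poly R}]_m := \matrix_(i, k)
  ((b i k y0 y0)%:P + (2 * b i k y0 y1) *: 'X + b i k y1 y1 *: 'X^2).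
have Mpsd : psd_pmx M.
  split=> [|v t]; first by apply/matrixP=> i k; rewrite !mxE !(b_x k i).
  have := form_ge0 (\row_i (v 0 i).[t]) (\row_j [:: 1; t; 0]`_j).
  rewrite exchange_big mxE horner_sum; congr (0 <= _); apply: eq_bigr => k _.
  rewrite !mxE hornerM horner_sum mulr_suml; apply: eq_bigr => i _.
  rewrite !big_ord_recl !big_ord0 !mxE /=.
  rewrite !(hornerD, hornerM, hornerC, hornerZ, hornerX, hornerXn).
  have -> : lift ord0 ord0 = y1 by apply: val_inj.
  by rewrite (b_y _ _ y1 y0); ring.
have M_size i : (size (M i i) <= 3)%N.
  rewrite mxE (leq_trans (size_polyD _ _)) // geq_max andbC.
  rewrite (leq_trans (size_scale_leq _ _)) ?size_polyXn //=.
  rewrite (leq_trans (size_polyD _ _)) // geq_max andbC.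
  rewrite (leq_trans (size_scale_leq _ _)) ?size_polyX //=.
  by rewrite (leq_trans (size_polyC_leq1 _)).
have [C [D /= MN]] := linear_factorization Mpsd M_size.
have MikE i k : M i k = (\sum_s C i s * C k s)%:P
    + (\sum_s (C i s * D k s + D i s * C k s)) *: 'X
    + (\sum_s D i s * D k s) *: 'X^2.
  rewrite MN mxE raddf_sum !scaler_suml -!big_split; apply: eq_bigr => s _.
  rewrite !mxE -!mul_polyC /=; ring.
have quad_inj (a c e a' c' e' : R) : a%:P + c *: 'X + e *: 'X^2
    = a'%:P + c' *: 'X + e' *: 'X^2 -> [/\ a = a', c = c' & e = e'].
  have coefs (x y z : R) (f := x%:P + y *: 'X + z *: 'X^2) :
      [/\ f`_0 = x, f`_1 = y & f`_2 = z].
    by rewrite !coefD !coefC !coefZ !coefX !coefXn /= !(mulr0, mulr1, addr0, add0r).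
  by move=> eq_f; have [] := coefs a c e; rewrite eq_f; have [-> -> ->] := coefs a' c' e'.
have [CC CD DD] : [/\ forall i k, \sum_s C i s * C k s = b i k y0 y0,
    forall i k, \sum_s C i s * D k s + \sum_s D i s * C k s = 2 * b i k y0 y1 &
    forall i k, \sum_s D i s * D k s = b i k y1 y1].
  by split=> i k; have := MikE i k; rewrite [M i k]mxE => /quad_inj[e0 e1 e2];
    rewrite ?e0 ?e1 ?e2 ?big_split.
pose A j i s := if j == y0 then C i s else if j == y1 then D i s else 0.
pose c (s : 'I_(m.+1 + m)) : 'M[R]_(m, 3) := \matrix_(i, j)
  match split s with
  | inl s => A j i s
  | inr r => if (i == r) && (j == y2) then Num.sqrt (b r r y2 y2) else 0
  end.
have cE i k j l : \sum_s c s i j * c s k l =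
    \sum_s A j i s * A l k s + if [&& i == k, j == y2 & l == y2] then b i i y2 y2 else 0.
  rewrite big_split_ord; congr (_ + _).
    by apply: eq_bigr => s _; rewrite !mxE (unsplitK (inl s)).
  rewrite (bigD1 i) //= big1 ?addr0 => [|r r_neq]; last first.
    by rewrite !mxE (unsplitK (inr r)) eq_sym (negPf r_neq) mul0r.
  rewrite !mxE (unsplitK (inr i)) eqxx (eq_sym i k).
  case: (k == i) (j == y2) (l == y2) => [] [] [] //=; rewrite ?mulr0 ?mul0r //.
  by rewrite -expr2 sqr_sqrtr.
exists c; rewrite sum_sqr_bilinear PE; apply: biquadratic_sym_eq => i k j l.
rewrite !cE.
have b02 : b i k y0 y2 = 0 by rewrite b_y2 // andbF.
have b12 : b i k y1 y2 = 0 by rewrite b_y2 // andbF.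
have b22 : b i k y2 y2 = if i == k then b i i y2 y2 else 0.
  by case: eqVneq => [->|/negPf ne] //; rewrite b_y2 // ne.
have ord3 (j' : 'I_3) : [\/ j' = y0, j' = y1 | j' = y2].
  by case: j' => -[|[|[|]]] //= lt3; [apply: Or31|apply: Or32|apply: Or33]; apply: val_inj.
have zl (F : 'I_m.+1 -> R) : \sum_s 0 * F s = 0 by rewrite big1 // => s _; rewrite mul0r.
have zr (F : 'I_m.+1 -> R) : \sum_s F s * 0 = 0 by rewrite big1 // => s _; rewrite mulr0.
rewrite /A; case: (ord3 j) => ->; case: (ord3 l) => -> /=;
  rewrite ?andbF ?andbT ?addr0 ?CC ?DD ?zl ?zr ?add0r //.
- by rewrite CD (b_y i k y1) mulr_natl mulr2n.
- by rewrite (b_y i k y2) b02 addr0.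
- by rewrite addrC [RHS]addrC CD (b_y i k y1) mulr_natl mulr2n.
- by rewrite (b_y i k y2) b12 addr0.
- by rewrite (b_y i k y2) b02 addr0.
- by rewrite (b_y i k y2) b12 addr0.
by rewrite b22.
Qed.

End YDeficient.

(* Indices start at 0, so the variable y_3 is the one of index ord_max in 'I_3 *)
Theorem theorem3p2 (R : realType) (P : bipoly R 4 3)
  (P_biquadratic : biquadratic_form P)
  (P_psd : psd P)
  (P_deficient : y_deficient_in (ord_max : 'I_3) P) :
  sos_rank_le P 9.
Proof.
apply: sos_rank_le_of_sum_of_squares.
exact: sum_of_squares_y_deficient P_biquadratic P_psd P_deficient.
Qed.
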